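(* Let $c\ge0$ be a fixed integer and let $\widetilde{K}_{c,n}$ be the graph obtained from the complete bipartite graph $K_{c,n}$ by adding, for each vertex $v$, a new vertex $v'$ adjacent only to $v$. Then $\lim_{n\to\infty}\mathcal{I}(\widetilde{K}_{c,n})=1$.
   Context: For a finite simple graph $G$: a matching is a set of pairwise vertex-disjoint edges; it is maximal if not contained in a larger matching. $\nu(G)$ is the maximum matching size, $\mathcal{T}_0(G)$ the number of maximal matchings, $\mathcal{T}_1(G)$ the sum of the sizes of all maximal matchings, and $\mathcal{I}(G)=\frac{\mathcal{T}_1(G)}{\nu(G)\mathcal{T}_0(G)}$ (equal to $1$ by convention if $\nu(G)=0$). *)

(* Defs.v *)
From mathcomp Require Import all_boot all_order all_algebra.

Set Implicit Arguments.
Unset Strict Implicit.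
Unset Printing Implicit Defensive.

Import GRing.Theory Num.Theory.

Record sgraph := SGraph {
  vertex : finType;
  adj : rel vertex;
  adj_sym : symmetric adj;
  adj_irrefl : irreflexive adj
}.

Section Matchings.
Variable G : sgraph.

Definition edges : {set {set vertex G}} :=
  [set e | [exists x : vertex G, exists y : vertex G,
              adj x y && (e == [set x; y])]].

Definition matching (M : {set {set vertex G}}) : bool :=
  (M \subset edges) &&
  [forall e in M, forall f in M, (e != f) ==> [disjoint e & f]].

Definition maximal_matching (M : {set {set vertex G}}) : bool :=
  maxset matching M.

Definition nu : nat :=
  \max_(M : {set {set vertex G}} | matching M) #|M|.

Definition T0 : nat := #|[set M | maximal_matching M]|.

Definition T1 : nat :=
  \sum_(M : {set {set vertex G}} | maximal_matching M) #|M|.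

Definition calI (R : numFieldType) : R :=
  if nu == 0 then 1%R else ((T1%:R : R) / (nu%:R * T0%:R))%R.

End Matchings.

Section CompleteBipartite.
Variables c n : nat.

Definition Kbip_adj : rel ('I_c + 'I_n)%type := fun x y =>
  match x, y with
  | inl _, inr _ | inr _, inl _ => true
  | _, _ => false
  end.

Fact Kbip_sym : symmetric Kbip_adj.
Proof. by do 2 case=> ?. Qed.

Fact Kbip_irrefl : irreflexive Kbip_adj.
Proof. by case. Qed.

Definition Kbip : sgraph := SGraph Kbip_sym Kbip_irrefl.

End CompleteBipartite.

(* [inl v] is the vertex v of G and [inr v] is its new neighbour v'. *)
Section Pendant.
Variable G : sgraph.

Definition pendant_adj : rel (vertex G + vertex G)%type := fun x y =>
  match x, y with
  | inl u, inl v => adj u v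
  | inl u, inr v | inr u, inl v => u == v
  | inr _, inr _ => false
  end.

Fact pendant_sym : symmetric pendant_adj.
Proof. by case=> u; case=> v //=; first exact: adj_sym. Qed.

Fact pendant_irrefl : irreflexive pendant_adj.
Proof. by case=> u //=; exact: adj_irrefl. Qed.

Definition pendant : sgraph := SGraph pendant_sym pendant_irrefl.

End Pendant.

Definition Ktilde (c n : nat) : sgraph := pendant (Kbip c n).

(* Main.v *)
(** A maximal matching of a graph with a pendant edge at every vertex covers
    every original vertex, since an uncovered [v] could be matched to [v'].
    Hence it has at least as many edges as any independent set of the original
    graph, and every matching has at most as many edges as there are original
    vertices.  In the case at hand all sizes of maximal matchings lie between
    [n] and [c + n], so the average size over the maximum size lies between
    [n / (c + n)] and [1]. *)
Require Import Defs.
From mathcomp Require Import all_boot all_order all_algebra.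
From mathcomp Require Import all_classical all_reals all_analysis.

Import Order.TTheory GRing.Theory Num.Theory.
Import numFieldNormedType.Exports.
Local Open Scope classical_set_scope.
Local Open Scope ring_scope.

Section Matchings.
Variable G : sgraph.
Implicit Types M : {set {set vertex G}}.

Lemma edgesP (e : {set vertex G}) :
  reflect (exists x y, adj x y /\ e = [set x; y]%SET) (e \in edges G).
Proof.
rewrite inE; apply: (iffP existsP) => [[x /existsP[y /andP[xy /eqP->]]]|].
  by exists x, y.
by case=> x [y [xy ->]]; exists x; apply/existsP; exists y; rewrite xy eqxx.
Qed.

(** Pairwise disjointness is recast as [trivIset], so that [pblock M x] can serve as the edge of [M]
    covering [x]. *)
Lemma matchingP M :
  reflect (M \subset edges G /\ finset.trivIset M) (matching M).
Proof.
apply: (iffP andP) => -[sM dM]; split=> //.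
  apply/finset.trivIsetP => e f eM fM ef.
  by move/forall_inP: dM => /(_ e eM) /forall_inP /(_ f fM) /implyP /(_ ef).
apply/forall_inP => e eM; apply/forall_inP => f fM; apply/implyP.
exact: (finset.trivIsetP dM).
Qed.

Lemma matching0 : matching (finset.set0 : {set {set vertex G}}).
Proof. by apply/matchingP; rewrite finset.sub0set; split=> //; apply/finset.trivIsetP => e; rewrite inE. Qed.

Lemma maximal_matching_matching M : maximal_matching M -> matching M.
Proof. exact: maxsetp. Qed.

(** The empty matching extends to a maximal one; this makes the denominator of [calI] positive once
    [nu] is nonzero. *)
Lemma T0_gt0 : (0 < T0 G)%N.
Proof.
have [M maxM _] := maxset_exists matching0.
by apply/card_gt0P; exists M; rewrite inE.
Qed.

Lemma card_matching_le_nu M : matching M -> (#|M| <= nu G)%N.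
Proof. by move=> mM; rewrite /nu; exact: leq_bigmax_cond. Qed.

Lemma T1_le : (T1 G <= nu G * T0 G)%N.
Proof.
rewrite /T0 -sum1_card big_distrr /= /T1 big_mkcond [leqRHS]big_mkcond /=.
apply: leq_sum => M _; rewrite inE muln1.
by case: ifP => // /maximal_matching_matching/card_matching_le_nu.
Qed.

Lemma T1_ge a : (forall M, maximal_matching M -> (a <= #|M|)%N) ->
  (a * T0 G <= T1 G)%N.
Proof.
move=> leaM; rewrite /T0 -sum1_card big_distrr /= /T1 big_mkcond [leqRHS]big_mkcond /=.
by apply: leq_sum => M _; rewrite inE muln1; case: ifP => // /leaM.
Qed.

Lemma calI_le1 (R : numFieldType) : calI G R <= 1.
Proof.
rewrite /calI; case: eqP => // /eqP nu0.
rewrite ler_pdivrMr; last by rewrite -natrM ltr0n muln_gt0 lt0n nu0 T0_gt0.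
by rewrite mul1r -natrM ler_nat T1_le.
Qed.

Lemma calI_ge (R : numFieldType) a b :
  (forall M, maximal_matching M -> (a <= #|M|)%N) -> (nu G <= b)%N ->
  (a <= b)%N -> a%:R / b%:R <= calI G R.
Proof.
move=> leaM leb; have [->|b0] := posnP b.
  (* Division by zero yields 0, so only nonnegativity of [calI] remains. *)
  by rewrite invr0 mulr0 /calI; case: ifP => // _ _; rewrite divr_ge0 ?mulr_ge0.
move=> ab; rewrite /calI; case: eqP => [_|/eqP nu0].
  (* Here [calI] is 1 by convention, and [a <= b] gives the bound. *)
  by rewrite ler_pdivrMr ?ltr0n // mul1r ler_nat.
rewrite ler_pdivlMr; last by rewrite -natrM ltr0n muln_gt0 lt0n nu0 T0_gt0.
rewrite mulrAC ler_pdivrMr ?ltr0n // -!natrM ler_nat.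
by rewrite mulnCA mulnC leq_mul // T1_ge.
Qed.

End Matchings.

Section Pendant.
Variable G : sgraph.
Implicit Types M : {set {set vertex (pendant G)}}.

Lemma pendant_edge_inl (e : {set vertex (pendant G)}) :
  e \in edges (pendant G) -> exists u : vertex G, inl u \in e.
Proof.
case/edgesP => -[u|u] [[v|v]] [//= uv ->]; last by exists v; rewrite !inE eqxx orbT.
  by exists u; rewrite !inE eqxx.
by exists u; rewrite !inE eqxx.
Qed.

Lemma pendant_edge_inr (e : {set vertex (pendant G)}) (v : vertex G) :
  e \in edges (pendant G) -> inr v \in e -> inl v \in e.
Proof.
by case/edgesP => -[u|u] [[w|w]] [//= uw ->]; rewrite !inE // ?(eqP uw) ?eqxx ?orbT ?orbF.
Qed.

Lemma pendant_edge_inl2 (e : {set vertex (pendant G)}) (u v : vertex G) :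
  e \in edges (pendant G) -> inl u \in e -> inl v \in e ->
  u = v \/ adj u v.
Proof.
case/edgesP => -[x|x] [[y|y]] [//= xy ->]; rewrite !inE ?orbF //=.
- by move=> /orP[]/eqP[->] /orP[]/eqP[->]; auto; rewrite adj_sym; auto.
- by move=> /eqP[->] /eqP[->]; auto.
- by move=> /eqP[->] /eqP[->]; auto.
Qed.

Lemma pendant_maximal_cover M (v : vertex G) :
  maximal_matching M -> inl v \in finset.cover M.
Proof.
move=> /maxsetP[/matchingP[sM tM] maxM]; apply/negP => /negP vM.
set e : {set vertex (pendant G)} := [set inl v; inr v]%SET.
have eE : e \in edges (pendant G).
  by apply/edgesP; exists (inl v), (inr v); rewrite /= eqxx.
have disj f : f \in M -> fintype.disjoint (mem e) (mem f).
  move=> fM; have vf : inl v \notin f.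
    by apply: contra vM => vf; apply/finset.bigcupP; exists f.
  rewrite finset.disjoints_subset finset.subUset !finset.sub1set !inE vf /=.
  (* An edge through the new vertex [inr v] also contains [inl v], its only neighbour. *)
  by apply: contra vf; exact/pendant_edge_inr/(fintype.subsetP sM).
have eM : e \in M.
  (* By maximality [e |: M] equals [M] as soon as it is a matching. *)
  rewrite -(maxM (e |: M)%SET) ?finset.setU11 ?finset.subsetUr //.
  apply/matchingP; split; first by rewrite finset.subUset finset.sub1set eE.
  apply/finset.trivIsetP => f g /finset.setU1P[->|fM] /finset.setU1P[->|gM] fg.
  - by rewrite eqxx in fg.
  - exact: disj.
  - by rewrite disjoint_sym; exact: disj.
  - exact: (finset.trivIsetP tM).
by case/negP: vM; apply/finset.bigcupP; exists e; rewrite // !inE eqxx.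
Qed.

(** Every edge contains an original vertex, so [M] lies in the image of the map sending [v] to its
    block; uncovered vertices go to the empty set, which does no harm. *)
Lemma pendant_card_matching M : matching M -> (#|M| <= #|vertex G|)%N.
Proof.
move=> /matchingP[sM tM].
apply: leq_trans (leq_imset_card (fun v => finset.pblock M (inl v)) (vertex G)).
apply/subset_leq_card/fintype.subsetP => e eM.
have [v ve] := pendant_edge_inl _ (fintype.subsetP sM e eM).
by apply/imsetP; exists v => //; rewrite (finset.def_pblock tM eM ve).
Qed.

(** Each [v] in [S] is covered by an edge of [M], and two distinct vertices of [S] cannot share one,
    as they would be adjacent. *)
Lemma pendant_card_maximal M (S : {set vertex G}) :
  {in S &, forall u v, ~~ adj u v} -> maximal_matching M -> (#|S| <= #|M|)%N.
Proof.
move=> indS maxM; have /matchingP[sM tM] := maximal_matching_matching _ _ maxM.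
have cov v := pendant_maximal_cover _ v maxM.
rewrite -(card_in_imset (f := fun v => finset.pblock M (inl v)) (D := S)).
  by apply/subset_leq_card/fintype.subsetP => _ /imsetP[v _ ->]; rewrite finset.pblock_mem.
move=> u v uS vS /= uv.
have vu : inl v \in finset.pblock M (inl u) by rewrite uv finset.mem_pblock.
have uE : finset.pblock M (inl u) \in edges (pendant G).
  by apply: (fintype.subsetP sM); rewrite finset.pblock_mem.
case: (pendant_edge_inl2 _ u v uE _ vu) => //; first by rewrite finset.mem_pblock.
by move=> auv; have := indS u v uS vS; rewrite auv.
Qed.

Lemma nu_pendant : (nu (pendant G) <= #|vertex G|)%N.
Proof. by apply/bigmax_leqP => M; exact: pendant_card_matching. Qed.

End Pendant.

Lemma calI_Ktilde_ge (R : numFieldType) c n :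
  n%:R / (c + n)%:R <= calI (Ktilde c n) R.
Proof.
apply: calI_ge; last exact: leq_addl; last first.
  by rewrite (leq_trans (nu_pendant _)) //= card_sum !card_ord.
move=> M maxM.
(* The independent set is the side of the bipartition with [n] vertices. *)
have cardS : #|[set inr j | j : 'I_n]%SET : {set vertex (Kbip c n)}| = n.
  by rewrite card_imset ?card_ord //; move=> i j [].
by rewrite -[leqLHS]cardS; apply: pendant_card_maximal maxM => _ _ /imsetP[i _ ->] /imsetP[j _ ->].
Qed.

Lemma cvg_natr_divD (R : realType) (c : nat) :
  (n%:R / (c + n)%:R : R) @[n --> \oo] --> (1 : R).
Proof.
(* The shift makes the numerator nonzero and matches [harmonic n], which is 1/(n+1). *)
rewrite -(cvg_shiftS (fun n => n%:R / (c + n)%:R : R)) /=.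
have -> : (fun n => n.+1%:R / (c + n.+1)%:R) =
          (fun n => (1 + c%:R * harmonic n)^-1 : R).
  apply/funext => n; rewrite /harmonic /=.
  have n0 : n.+1%:R != 0 :> R by rewrite pnatr_eq0.
  by rewrite -[LHS]invf_div natrD mulrDl divff // addrC.
have lim1 : 1 + c%:R * harmonic n @[n --> \oo] --> (1 + c%:R * 0 : R).
  by apply: cvgD; [exact: cvg_cst|apply: cvgM; [exact: cvg_cst|exact: cvg_harmonic]].
rewrite mulr0 addr0 in lim1.
by have := cvgV (oner_neq0 R) lim1; rewrite invr1; apply.
Qed.

Theorem theorem12 (R : realType) (c : nat) :
  calI (Ktilde c n) R @[n --> \oo] --> (1 : R).
Proof.
apply: (squeeze_cvgr (f := fun n => n%:R / (c + n)%:R) (h := fun=> 1)).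
- by apply: nearW => n; rewrite calI_Ktilde_ge calI_le1.
- exact: cvg_natr_divD.
- exact: cvg_cst.
Qed.
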